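(* For every elastic moduli tensor $(c_{ijkl})$, with $$A_1=c_{ijij},\quad A_2=c_{iijj},\quad B_1=c_{ijkl}c_{ijkl},\quad B_2=c_{iikl}c_{jjkl},\quad B_3=c_{iikl}c_{jkjl},\quad B_4=c_{kiil}c_{kjjl},\quad B_5=c_{ijkl}c_{ikjl},$$ one has $$B_5=\tfrac12A_1^2+\tfrac12A_2^2-A_1A_2+B_1-2B_2+4B_3-2B_4 .$$ Consequently, every fourth-order elasticity tensor satisfies the identity $$2c_{ijkl}(c_{ijkl}-c_{ikjl})+(c_{iijj}-c_{ijij})^2-4(c_{ijkk}-c_{ikjk})(c_{ijll}-c_{iljl})=0 .$$
   Context: Summation over repeated indices in $\{1,2,3\}$ is assumed. An elastic moduli (elasticity) tensor is a real fourth-order tensor $(c_{ijkl})$, $i,j,k,l\in\{1,2,3\}$, with the symmetries $c_{ijkl}=c_{jikl}$ and $c_{ijkl}=c_{klij}$ (no positive-definiteness is needed). *)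

(* Defs.v *)
From mathcomp Require Import all_boot all_order all_algebra.
From mathcomp Require Import reals.

Set Implicit Arguments.
Unset Strict Implicit.
Unset Printing Implicit Defensive.

Import GRing.Theory.
Local Open Scope ring_scope.

(* Component array of a fourth-order tensor over a three-dimensional space. *)
Definition tensor4 (R : realType) : Type := 'I_3 -> 'I_3 -> 'I_3 -> 'I_3 -> R.

(* Minor symmetry in the first pair and major symmetry; the minor symmetry in
   the second pair, c i j k l = c i j l k, follows from these two. *)
Definition elasticity_tensor (R : realType) (c : tensor4 R) : Prop :=
  (forall i j k l, c i j k l = c j i k l) /\
  (forall i j k l, c i j k l = c k l i j).

(* Every index range below is {1, 2, 3}, represented by 'I_3. *)
Section Invariants.

Variables (R : realType) (c : tensor4 R).

Definition A1 : R := \sum_(i < 3) \sum_(j < 3) c i j i j.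

Definition A2 : R := \sum_(i < 3) \sum_(j < 3) c i i j j.

Definition B1 : R :=
  \sum_(i < 3) \sum_(j < 3) \sum_(k < 3) \sum_(l < 3) c i j k l * c i j k l.

Definition B2 : R :=
  \sum_(i < 3) \sum_(j < 3) \sum_(k < 3) \sum_(l < 3) c i i k l * c j j k l.

Definition B3 : R :=
  \sum_(i < 3) \sum_(j < 3) \sum_(k < 3) \sum_(l < 3) c i i k l * c j k j l.

Definition B4 : R :=
  \sum_(i < 3) \sum_(j < 3) \sum_(k < 3) \sum_(l < 3) c k i i l * c k j j l.

Definition B5 : R :=
  \sum_(i < 3) \sum_(j < 3) \sum_(k < 3) \sum_(l < 3) c i j k l * c i k j l.

End Invariants.

(* Main.v *)
Require Import Defs.
From mathcomp Require Import all_boot all_order all_algebra.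
From mathcomp Require Import reals.
From mathcomp Require Import ring.
Import GRing.Theory.
Local Open Scope ring_scope.

(** By the symmetries a tensor has 21 independent components, one for each
    unordered pair (possibly equal) of the six unordered index pairs; written
    in these, the second identity becomes an equality of polynomials. Its
    left-hand side is [2 (B1 - B5) + (A2 - A1)^2 - 4 (B2 - 2 B3 + B4)], so the
    formula for [B5] is the same identity solved for [B5]. *)

Definition o0 : 'I_3 := ord0.
Definition o1 : 'I_3 := lift ord0 ord0.
Definition o2 : 'I_3 := lift ord0 (lift ord0 ord0).

Lemma sum_ord3 (V : nmodType) (F : 'I_3 -> V) :
  \sum_(i < 3) F i = F o0 + F o1 + F o2.
Proof. by rewrite !big_ord_recl big_ord0 addr0 addrA. Qed.

Lemma exchange_sum_pairs (V : nmodType) (I : finType)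
    (F : I -> I -> I -> I -> V) :
  \sum_i \sum_j \sum_k \sum_l F i j k l =
  \sum_i \sum_j \sum_k \sum_l F k l i j.
Proof.
under eq_bigr => i _ do (rewrite exchange_big;
  under eq_bigr => k _ do rewrite exchange_big).
rewrite exchange_big; apply: eq_bigr => k _.
by rewrite exchange_big.
Qed.

Lemma elasticity_minor_right {R : realType} {c : tensor4 R} :
  elasticity_tensor c -> forall i j k l, c i j k l = c i j l k.
Proof. by case=> minor major i j k l; rewrite major minor major. Qed.

Lemma elasticity_invariants {R : realType} {c : tensor4 R} :
  elasticity_tensor c ->
  2 * (B1 c - B5 c) + (A2 c - A1 c) ^+ 2
    - 4 * (B2 c - 2 * B3 c + B4 c) = 0.
Proof.
move=> hc; have minorr := elasticity_minor_right hc; case: hc => minor major.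
rewrite /B1 /B2 /B3 /B4 /B5 /A1 /A2 !sum_ord3.
(* Each index pair is sorted, then the two pairs are put in the Voigt order 00, 11, 22, 12, 02, 01.
   The fifteen instances of [major] are its out-of-order combinations. *)
rewrite !(minor o1 o0, minor o2 o0, minor o2 o1).
rewrite !(minorr _ _ o1 o0, minorr _ _ o2 o0, minorr _ _ o2 o1).
rewrite !(major o1 o1 o0 o0, major o2 o2 o0 o0, major o1 o2 o0 o0,
  major o0 o2 o0 o0, major o0 o1 o0 o0, major o2 o2 o1 o1,
  major o1 o2 o1 o1, major o0 o2 o1 o1, major o0 o1 o1 o1,
  major o1 o2 o2 o2, major o0 o2 o2 o2, major o0 o1 o2 o2,
  major o0 o2 o1 o2, major o0 o1 o1 o2, major o0 o1 o0 o2).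
clear minor minorr major.
repeat match goal with |- context [c ?i ?j ?k ?l] =>
  move: (c i j k l) => ? end.
ring.
Qed.

Theorem mainTheorem5 (R : realType) (c : tensor4 R) (hc : elasticity_tensor c) :
  B5 c = 2^-1 * A1 c ^+ 2 + 2^-1 * A2 c ^+ 2 - A1 c * A2 c
         + B1 c - 2 * B2 c + 4 * B3 c - 2 * B4 c
  /\
  2 * (\sum_(i < 3) \sum_(j < 3) \sum_(k < 3) \sum_(l < 3)
         c i j k l * (c i j k l - c i k j l))
  + (\sum_(i < 3) \sum_(j < 3) (c i i j j - c i j i j)) ^+ 2
  - 4 * (\sum_(i < 3) \sum_(j < 3) \sum_(k < 3) \sum_(l < 3)
           (c i j k k - c i k j k) * (c i j l l - c i l j l)) = 0.
Proof.
have rel := elasticity_invariants hc; have minorr := elasticity_minor_right hc.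
have [minor major] := hc.
split.
  apply/eqP; rewrite -subr_eq0; apply/eqP.
  (* [B5] has coefficient -2 in [rel], whence the factor [- 2^-1]. *)
  transitivity (- 2^-1 * (2 * (B1 c - B5 c) + (A2 c - A1 c) ^+ 2
    - 4 * (B2 c - 2 * B3 c + B4 c))); last by rewrite rel mulr0.
  by field.
rewrite -[RHS]rel; congr (2 * _ + _ ^+ 2 - 4 * _).
- rewrite /B1 /B5 -sumrB; apply: eq_bigr => i _.
  rewrite -sumrB; apply: eq_bigr => j _.
  rewrite -sumrB; apply: eq_bigr => k _.
  by rewrite -sumrB; apply: eq_bigr => l _; rewrite mulrBr.
- by rewrite /A2 /A1 -sumrB; apply: eq_bigr => i _; rewrite -sumrB.
(* The goal contracts over [k] and [l], whereas [B2], [B3], [B4] contract over [i] and [j]. *)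
- rewrite exchange_sum_pairs.
  (* The product has two cross terms, mirror images under [i] and [j]; each needs its own copy of
     [B3]. *)
  have -> : B2 c - 2 * B3 c + B4 c = B2 c - B3 c - B3 c + B4 c by ring.
  rewrite [X in _ - X + _]/B3.
  (* Exchanging i and j in one copy of B3 makes the identity hold termwise. *)
  have -> : \sum_(i < 3) \sum_(j < 3) \sum_(k < 3) \sum_(l < 3)
      c i i k l * c j k j l = \sum_(i < 3) \sum_(j < 3) \sum_(k < 3)
      \sum_(l < 3) c j j k l * c i k i l by rewrite exchange_big.
  rewrite /B2 /B3 /B4 -!sumrB -big_split; apply: eq_bigr => i _.
  rewrite -!sumrB -big_split; apply: eq_bigr => j _.
  rewrite -!sumrB -big_split; apply: eq_bigr => k _.
  rewrite -!sumrB -big_split; apply: eq_bigr => l _ /=.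
  (* All contractions are brought to the forms [c i i k l] and [c k i i l], or the same with [j]. *)
  rewrite !(major k l) (minorr k i l i) (minorr k j l j).
  rewrite (minor i k i l) (minor j k j l).
  by ring.
Qed.
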